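(* For every integer $n\ge2$, there exists a non-zero set ideal of $\mathbb C[X_1,\ldots,X_n]$ which is not of type C.
   Context: $\mathbb C[X_1,\ldots,X_n]$ is regarded as a $*$-algebra with the involution (conjugate-linear) for which $X_j^*=X_j$ for all $j$. A set ideal of $\mathbb C[X_1,\ldots,X_n]$ is an ideal of the form $\mathcal I_{\mathsf c}(Z)=\{R\in\mathbb C[X_1,\ldots,X_n]: R(x)=0\text{ for every }x\in Z\}$ for some $Z\subset\mathbb R^n$. A complex linear functional $\Lambda:\mathbb C[X_1,\ldots,X_n]\to\mathbb C$ is positive definite if $\Lambda(R^*R)\ge0$ for all $R$; for such $\Lambda$ put $\mathcal I^{\mathsf c}_\Lambda=\{R:\Lambda(R^*R)=0\}$. $\Lambda$ is a moment functional if there is a positive Borel measure $\mu$ on $\mathbb R^n$, with respect to which all polynomials are absolutely integrable, such that $\Lambda(R)=\int_{\mathbb R^n}R\,d\mu$ for all $R\in\mathbb C[X_1,\ldots,X_n]$. A $*$-ideal $I$ of $\mathbb C[X_1,\ldots,X_n]$ (an ideal closed under the involution) is of type C if every positive definite complex linear functional $\Lambda$ on $\mathbb C[X_1,\ldots,X_n]$ satisfying $\mathcal I^{\mathsf c}_\Lambda=I$ is a moment functional. *)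

(* Defs.v *)
From HB Require Import structures.
From mathcomp Require Import all_boot all_order all_algebra.
From mathcomp Require Import complex.
(* The notations of [mpoly] clash with those of MathComp-Analysis. *)
From mathcomp Require Import -(notations) mpoly.
From mathcomp Require Import boolp classical_sets functions reals ereal.
From mathcomp Require Import topology normedtype measure lebesgue_measure.
From mathcomp Require Import lebesgue_integral.

Set Implicit Arguments.
Unset Strict Implicit.
Unset Printing Implicit Defensive.

Import Order.TTheory GRing.Theory Num.Theory.
Import numFieldNormedType.Exports.

Local Open Scope classical_set_scope.
Local Open Scope ring_scope.

Notation cpoly R n := (mpoly n R[i]).

Definition peval (R : realType) (n : nat) (p : cpoly R n) (x : 'rV[R]_n) :
    R[i] :=
  meval (fun j => (x ord0 j)%:C%C) p.

(* Conjugating the coefficients is the conjugate-linear ring involution that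
   fixes every variable. *)
Definition star (R : realType) (n : nat) (p : cpoly R n) : cpoly R n :=
  map_mpoly (@conjc R) p.

(* Unlike MathComp's [idealr], this allows the whole ring. *)
Definition is_ideal (R : realType) (n : nat) (I : set (cpoly R n)) : Prop :=
  [/\ I 0,
      forall p q, I p -> I q -> I (p + q)
    & forall r p, I p -> I (r * p)].

Definition is_star_ideal (R : realType) (n : nat) (I : set (cpoly R n)) :
    Prop :=
  is_ideal I /\ forall p, I p -> I (star p).

Definition vanishing_ideal (R : realType) (n : nat) (Z : set 'rV[R]_n) :
    set (cpoly R n) :=
  [set p | forall x, Z x -> peval p x = 0].

Definition is_set_ideal (R : realType) (n : nat) (I : set (cpoly R n)) : Prop :=
  exists Z : set 'rV[R]_n, I = vanishing_ideal Z.

(* In the order of [R[i]], [0 <= z] means that z is real and nonnegative. *)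
Definition positive_definite (R : realType) (n : nat)
    (L : {scalar (cpoly R n)}) : Prop :=
  forall p, 0 <= L (star p * p).

Definition null_ideal (R : realType) (n : nat) (L : {scalar (cpoly R n)}) :
    set (cpoly R n) :=
  [set p | L (star p * p) = 0].

Notation borelRn R n := (g_sigma_algebraType (@open 'rV[R]_n)).

Definition cintegrable (R : realType) (n : nat)
    (mu : {measure set (borelRn R n) -> \bar R}) (f : 'rV[R]_n -> R[i]) :
    Prop :=
  [/\ measurable_fun [set: borelRn R n] (@complex.Re R \o f),
      measurable_fun [set: borelRn R n] (@complex.Im R \o f)
    & (\int[mu]_x (Normc.normc (f x))%:E < +oo)%E].

Definition cintegral (R : realType) (n : nat)
    (mu : {measure set (borelRn R n) -> \bar R}) (f : 'rV[R]_n -> R[i]) :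
    R[i] :=
  Complex (\int[mu]_x complex.Re (f x))%R (\int[mu]_x complex.Im (f x))%R.

Definition moment_functional (R : realType) (n : nat)
    (L : {scalar (cpoly R n)}) : Prop :=
  exists mu : {measure set (borelRn R n) -> \bar R},
    (forall p, cintegrable mu (peval p)) /\
    (forall p, L p = cintegral mu (peval p)).

(* [type_C] is meaningful for *-ideals only; every set ideal is one, see
   [set_ideal_star_ideal]. *)
Definition type_C (R : realType) (n : nat) (I : set (cpoly R n)) : Prop :=
  forall L : {scalar (cpoly R n)},
    positive_definite L -> null_ideal L = I -> moment_functional L.

Lemma peval_star (R : realType) (n : nat) (p : cpoly R n) (x : 'rV[R]_n) :
  peval (star p) x = conjc (peval p x).
Proof.
rewrite /peval /star; elim/mpolyind: p => [|c m p _ _ IH].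
  by rewrite !rmorph0.
have -> q : map_mpoly (@conjc R) (q + p) = map_mpoly (@conjc R) q +
    map_mpoly (@conjc R) p by exact: rmorphD.
rewrite !mevalD IH (map_mpolyZ (@conjc R)) map_mpolyX !mevalZ !mevalX.
rewrite rmorphD rmorphM rmorph_prod; congr (_ * _ + _).
by apply: eq_bigr => j _; rewrite rmorphXn /= oppr0.
Qed.

Lemma set_ideal_star_ideal (R : realType) (n : nat) (I : set (cpoly R n)) :
  is_set_ideal I -> is_star_ideal I.
Proof.
move=> [Z ->]; split; first split.
- by move=> x _; exact: meval0.
- move=> p q Ip Iq x Zx; rewrite /peval mevalD.
  by rewrite [X in X + _]Ip // [X in _ + X]Iq // addr0.
- by move=> r p Ip x Zx; rewrite /peval mevalM [X in _ * X]Ip // mulr0.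
- by move=> p Ip x Zx; rewrite peval_star Ip // rmorph0.
Qed.

(* Main.v *)
Require Import Defs.
From HB Require Import structures.
From mathcomp Require Import all_boot all_order all_algebra.
From mathcomp Require Import complex.
From mathcomp Require Import -(notations) mpoly.
From mathcomp Require Import classical_sets reals measure lebesgue_integral.
From mathcomp Require Import zify ring lra.

(** Take the cusp [y^2 = x^3] in [R^n], parametrized by [(t^2, t^3, 0, ..., 0)].
    Pulling back along the parametrization identifies the polynomials modulo the
    vanishing ideal of the cusp with the polynomials in [t] having no linear
    term. For these, the value [s_2] at [t^2] never sits on the diagonal of the
    form [sum s_(i+j) conj(f_i) f_j], [i, j <> 1], so it may be negative: with
    [s_m = 2^(m^3)], except for the sign of [s_2], the moments grow so fast that
    the form is diagonally dominant after rescaling, hence strictly positive. No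
    measure represents this functional, because [x] is nonnegative on the
    cusp. *)

Set Implicit Arguments.
Unset Strict Implicit.
Unset Printing Implicit Defensive.
Import GRing.Theory Num.Theory Order.TTheory.
Local Open Scope classical_set_scope.
Local Open Scope ring_scope.

(** * Diagonally dominant Hermitian forms *)

Lemma addV2V2 (C : numFieldType) : 2^-1 + 2^-1 = 1 :> C.
Proof. by rewrite [RHS]splitr mul1r. Qed.

Lemma sum_pow2V_le2 (C : numFieldType) (N : nat) :
  \sum_(i < N) 2^-1 ^+ i <= 2 :> C.
Proof.
suff -> : \sum_(i < N) 2^-1 ^+ i = 2 - 2 * 2^-1 ^+ N :> C.
  by rewrite gerBl mulr_ge0 ?exprn_ge0 ?invr_ge0 ?ler0n.
elim: N => [|N IHN]; first by rewrite big_ord0 expr0 mulr1 subrr.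
rewrite big_ord_recr /= IHN exprS mulrA divff ?pnatr_eq0// mul1r.
by rewrite mulr_natl mulr2n opprD addrA addrNK.
Qed.

Section DiagonalDominance.
Context {C : numClosedFieldType} {N : nat}.
Implicit Types (A : 'I_N -> 'I_N -> C) (g : 'I_N -> C).

(* AM-GM and the row sums [\sum_j 2 ^- (i + j + 2) <= 2 ^- (i + 1) <= 1/2]. *)
Lemma sum_geometric_kernel_le g :
  \sum_i \sum_j `|g i| * `|g j| * 2^-1 ^+ (i + j + 2) <=
  2^-1 * \sum_i `|g i| ^+ 2.
Proof.
have h0 : 0 <= 2^-1 :> C by rewrite invr_ge0 ler0n.
pose c (i j : 'I_N) : C := 2^-1 ^+ (i + j + 2).
have c0 i j : 0 <= c i j by exact: exprn_ge0.
have row i : \sum_j c i j <= 2^-1.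
  have -> : \sum_j c i j = 2^-1 ^+ (i + 2) * \sum_(j < N) 2^-1 ^+ j.
    by rewrite mulr_sumr; apply: eq_bigr => j _; rewrite /c -exprD addnAC.
  apply: (@le_trans _ _ (2^-1 ^+ (i + 2) * 2)).
    by rewrite ler_wpM2l ?exprn_ge0 ?sum_pow2V_le2.
  rewrite addn2 exprSr -mulrA mulVf ?pnatr_eq0// mulr1 exprS.
  by rewrite ler_piMr// exprn_ile1// invf_le1 ?ltr0n// ler1n.
pose u i : C := `|g i| ^+ 2.
have u0 i : 0 <= u i by rewrite exprn_ge0.
apply: (@le_trans _ _
  (\sum_i \sum_j (2^-1 * (u i * c i j) + 2^-1 * (u j * c i j)))).
  apply: ler_sum => i _; apply: ler_sum => j _.
  rewrite -mulrDr -mulrDl mulrA ler_wpM2r// ?c0//.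
  rewrite ler_pdivlMl ?ltr0n// mulr_natl -subr_ge0 /u.
  have -> : `|g i| ^+ 2 + `|g j| ^+ 2 - `|g i| * `|g j| *+ 2 =
      (`|g i| - `|g j|) ^+ 2.
    by rewrite sqrrB addrAC.
  by rewrite real_exprn_even_ge0// realB ?normr_real.
under eq_bigr do rewrite big_split /=.
(* After exchanging the order of summation, the symmetry of the kernel makes the second sum equal to
   the first, so the single estimate [half] bounds both. *)
rewrite big_split /= [X in _ + X]exchange_big /=.
have half : \sum_i \sum_j 2^-1 * (u i * c i j) <=
    2^-1 * (2^-1 * \sum_i u i).
  rewrite mulr_sumr mulr_sumr; apply: ler_sum => i _.
  rewrite -mulr_sumr ler_wpM2l// -mulr_sumr [leRHS]mulrC ler_wpM2l//.
have cC i j : c i j = c j i by rewrite /c (addnC (nat_of_ord i)).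
have -> : \sum_i \sum_j 2^-1 * (u i * c j i) =
    \sum_i \sum_j 2^-1 * (u i * c i j).
  by apply: eq_bigr => i _; apply: eq_bigr => j _; rewrite cC.
apply: (le_trans (lerD half half)).
by rewrite -mulrDl addV2V2 mul1r.
Qed.

(** The kernel estimate bounds the norm of the off-diagonal part [E] by half the diagonal part [D],
    which leaves at least [D / 2]. The order of [C] is partial, so [E] must first be shown real:
    conjugation swaps the two indices. *)
Lemma hermitian_diag_dominant_ge A g :
  (forall i j, (A i j)^* = A j i) ->
  (forall i, A i i = `|g i| ^+ 2) ->
  (forall i j, i != j ->
    `|A i j| <= `|g i| * `|g j| * 2^-1 ^+ (i + j + 2)) ->
  2^-1 * \sum_i `|g i| ^+ 2 <= \sum_i \sum_j A i j.
Proof.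
move=> AC Ad Ao; pose D := \sum_i `|g i| ^+ 2.
pose E := \sum_i \sum_(j | j != i) A i j.
have -> : \sum_i \sum_j A i j = D + E.
  rewrite -big_split; apply: eq_bigr => i _.
  by rewrite (bigD1 i) //= Ad.
have Er : E \is Num.real.
  rewrite CrealE /E raddf_sum /=; apply/eqP.
  under eq_bigr do rewrite raddf_sum /= big_mkcond /=.
  rewrite exchange_big /=; apply: eq_bigr => i _.
  rewrite [RHS]big_mkcond; apply: eq_bigr => j _.
  by rewrite eq_sym AC.
have El : `|E| <= 2^-1 * D.
  apply: le_trans (sum_geometric_kernel_le g).
  apply: (le_trans (ler_norm_sum _ _ _)); apply: ler_sum => i _.
  apply: (le_trans (ler_norm_sum _ _ _)); rewrite big_mkcond /=.
  apply: ler_sum => j _; case: ifP => [ji|_]; first by rewrite Ao// eq_sym.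
  by rewrite !mulr_ge0// exprn_ge0// invr_ge0 ler0n.
have Dh : D = 2^-1 * D + 2^-1 * D.
  by rewrite -mulrDl addV2V2 mul1r.
rewrite -/D {2}Dh -addrA lerDl -(opprK E) subr_ge0.
apply: le_trans El; by rewrite -normrN real_ler_norm// realN.
Qed.

End DiagonalDominance.

(** * The rapidly growing moment sequence and its Hankel form *)

Definition cusp_moment {C : numFieldType} (m : nat) : C :=
  (-1) ^+ (m == 2) * 2 ^+ (m ^ 3).

(** The identity [4 i^3 + 4 j^3 - (i + j)^3 = 3 (i + j) (i - j)^2] gives a surplus of at least
    [3 (i + j)] when [i] and [j] differ, and then [i + j >= 1]. *)
Lemma cubeD_le (i j : nat) : i != j ->
  ((i + j) ^ 3 + (i + j + 2) <= 4 * i ^ 3 + 4 * j ^ 3)%N.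
Proof.
wlog ij : i j / (i <= j)%N.
  move=> H nij; have [ij|/ltnW ji] := leqP i j; first exact: H.
  by rewrite (addnC i) [leqRHS]addnC H// eq_sym.
(* Writing [j = i + k + 1] avoids truncated subtraction in the surplus. *)
move=> nij; have [k ->] : exists k, j = (i + k.+1)%N by exists (j - i).-1; lia.
rewrite !expnS !expn0 !muln1; nia.
Qed.

Lemma norm_cusp_momentD_le {C : numFieldType} (i j : nat) : i != j ->
  `|cusp_moment (i + j)| <=
  2 ^+ (4 * i ^ 3) * 2 ^+ (4 * j ^ 3) * 2^-1 ^+ (i + j + 2) :> C.
Proof.
move=> /cubeD_le ij; rewrite /cusp_moment normrM normrX normrN1 expr1n mul1r.
rewrite ger0_norm ?exprn_ge0 ?ler0n// exprVn ler_pdivlMr ?exprn_gt0 ?ltr0n//.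
by rewrite -!exprD ler_eXn2l// ltr1n.
Qed.

(** Rescaling by [2^(4 i^3)] normalizes the diagonal, because [2 * 4 i^3 = (2 i)^3]. The one
    diagonal entry of the wrong sign, at [i = 1], is killed by [f 1 = 0]. *)
Lemma cusp_moment_form_ge {C : numClosedFieldType} (f : nat -> C) (N : nat) :
  f 1%N = 0 ->
  2^-1 * \sum_(i < N) `|2 ^+ (4 * i ^ 3) * f i| ^+ 2 <=
  \sum_(i < N) \sum_(j < N) (f i)^* * f j * cusp_moment (i + j).
Proof.
move=> f1.
have w_ge0 i : 0 <= 2 ^+ (4 * i ^ 3) :> C by rewrite exprn_ge0 ?ler0n.
apply: hermitian_diag_dominant_ge => [i j|i|i j ij].
- rewrite !rmorphM /= conjCK [X in X * _]mulrC (addnC j); congr (_ * _).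
  by rewrite /cusp_moment !rmorphXn rmorphN1 rmorph_nat.
- have [i1|ni1] := eqVneq (i : nat) 1%N.
    by rewrite i1 f1 !mulr0 normr0 expr0n mul0r.
  rewrite normrM exprMn (ger0_norm (w_ge0 i)) normCK.
  rewrite [LHS]mulrC [X in _ * X]mulrC.
  congr (_ * _); rewrite -exprM /cusp_moment.
  have -> : (i + i == 2)%N = false by lia.
  by rewrite expr0 mul1r; congr (_ ^+ _); rewrite !expnS expn0; nia.
- rewrite (normrM (_ * _)) (normrM _^*) norm_conjC !(normrM (2 ^+ _)).
  rewrite !(ger0_norm (w_ge0 _)).
  rewrite [leRHS](_ : _ = `|f i| * `|f j| * (2 ^+ (4 * i ^ 3) *
    2 ^+ (4 * j ^ 3) * 2^-1 ^+ (i + j + 2))); last first.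
    by rewrite mulrACA [LHS]mulrAC mulrC.
  by rewrite ler_wpM2l ?mulr_ge0// norm_cusp_momentD_le.
Qed.

(** * Functionals on univariate polynomials with prescribed moments *)

Section RieszFunctional.
Context {C : comNzRingType} (s : nat -> C).

Definition riesz_functional (f : {poly C}) : C :=
  \sum_(k < size f) f`_k * s k.

Lemma riesz_functional_widen (f : {poly C}) N : (size f <= N)%N ->
  riesz_functional f = \sum_(k < N) f`_k * s k.
Proof.
move=> fN; rewrite /riesz_functional (big_ord_widen N (fun k => f`_k * s k) fN).
rewrite big_mkcond; apply: eq_bigr => k _; case: ltnP => // fk.
by rewrite nth_default// mul0r.
Qed.

Lemma riesz_functional_is_linear : scalar riesz_functional.
Proof.
move=> a f g; pose N := maxn (size (a *: f + g)) (maxn (size f) (size g)).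
rewrite !(@riesz_functional_widen _ N) /N ?leq_max ?leqnn ?orbT//.
rewrite mulr_sumr -big_split; apply: eq_bigr => k _ /=.
by rewrite coefD coefZ mulrDl mulrA.
Qed.

HB.instance Definition _ :=
  GRing.isLinear.Build C {poly C} C *%R riesz_functional
    riesz_functional_is_linear.

Lemma riesz_functionalXn k : riesz_functional 'X^k = s k.
Proof.
rewrite /riesz_functional size_polyXn big_ord_recr /= big1 => [|i _].
  by rewrite coefXn eqxx mul1r add0r.
by rewrite coefXn ltn_eqF// mul0r.
Qed.

Lemma riesz_functionalM (f g : {poly C}) N :
  (size f <= N)%N -> (size g <= N)%N ->
  riesz_functional (f * g) =
  \sum_(i < N) \sum_(j < N) f`_i * g`_j * s (i + j)%N.
Proof.
move=> fN gN.
have E (h : {poly C}) : (size h <= N)%N -> h = \sum_(i < N) h`_i *: 'X^i.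
  move=> hN; rewrite -poly_def; apply/polyP => k; rewrite coef_poly.
  by case: ltnP => // Nk; rewrite nth_default// (leq_trans hN).
rewrite {1}(E f fN) {1}(E g gN) mulr_suml linear_sum; apply: eq_bigr => i _.
rewrite mulr_sumr linear_sum; apply: eq_bigr => j _ /=.
by rewrite -scalerAl -scalerAr scalerA -exprD linearZ /= riesz_functionalXn.
Qed.

End RieszFunctional.

(** * Pullback along the cusp and the resulting functional *)

Section Cusp.
Context {R : realType} {n : nat}.
Local Notation C := (R[i]).
Implicit Types (p : cpoly R n) (t : R).

(** Generic in the semiring, to be used both at a real parameter and at the indeterminate ['X]. *)
Definition cusp_coord (T : pzSemiRingType) (t : T) (i : 'I_n) : T :=
  if i == 0 :> nat then t ^+ 2 else if i == 1 :> nat then t ^+ 3 else 0.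

Definition cusp_point t : 'rV[R]_n := \row_i cusp_coord t i.

Definition cusp_pullback p : {poly C} := mmap polyC (cusp_coord 'X) p.

HB.instance Definition _ := GRing.isZmodMorphism.Build (cpoly R n) {poly C}
  cusp_pullback (mmap_is_additive _ _).

Lemma cusp_pullback_is_monoid_morphism : monoid_morphism cusp_pullback.
Proof.
by have [M U] := mmap_is_multiplicative (cusp_coord 'X) (@polyC C).
Qed.

HB.instance Definition _ := GRing.isMonoidMorphism.Build (cpoly R n) {poly C}
  cusp_pullback cusp_pullback_is_monoid_morphism.


Lemma cusp_pullbackZ a p : cusp_pullback (a *: p) = a%:P * cusp_pullback p.
Proof. exact: mmapZ. Qed.

(** The predicate is binary so that one induction on monomials can relate a polynomial to its
    pullback; evaluation, involution and the linear coefficient are all handled this way. *)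
Lemma cusp_pullback_linear_ind (P : cpoly R n -> {poly C} -> Prop) :
  P 0 0 ->
  (forall a (m : multinom n) p f, P p f ->
     P (a *: mpolyX C m + p) (a%:P * \prod_i cusp_coord 'X i ^+ m i + f)) ->
  forall p, P p (cusp_pullback p).
Proof.
move=> P0 PD; elim/mpolyind => [|a m p _ _ IH]; first by rewrite rmorph0.
by rewrite rmorphD /= cusp_pullbackZ {1}/cusp_pullback mmapX; exact: PD.
Qed.

Lemma horner_cusp_pullback p t :
  (cusp_pullback p).[t%:C%C] = peval p (cusp_point t).
Proof.
have coordE i : (cusp_coord ('X : {poly C}) i).[t%:C%C] =
    (cusp_point t ord0 i)%:C%C.
  rewrite mxE /cusp_coord.
  by do 2?case: ifP => _; rewrite ?hornerXn ?horner0 ?rmorphXn.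
apply: (cusp_pullback_linear_ind
  (P := fun p f => f.[t%:C%C] = peval p (cusp_point t))).
  by rewrite horner0 /peval meval0.
move=> a m q f IH; rewrite /peval mevalD mevalZ mevalX.
rewrite hornerD hornerM hornerC IH horner_prod; congr (_ * _ + _).
apply: eq_bigr => i _.
by rewrite horner_exp coordE.
Qed.

Lemma cusp_pullback_eq0P p :
  cusp_pullback p = 0 <-> vanishing_ideal (range cusp_point) p.
Proof.
split=> [p0 _ [t _ <-]|pZ]; first by rewrite -horner_cusp_pullback p0 horner0.
(* The pullback vanishes at every real number; as many distinct roots as its size, one more than the
   degree, already force it to be zero. *)
pose rs : seq C := [seq k%:R | k <- iota 0 (size (cusp_pullback p))].
apply: (@roots_geq_poly_eq0 _ _ rs); last by rewrite size_map size_iota.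
- apply/allP => _ /mapP[k _ ->]; rewrite rootE -(rmorph_nat (real_complex R)).
  by rewrite /= horner_cusp_pullback pZ//; exists k%:R.
- rewrite map_inj_uniq ?iota_uniq// => i j /eqP.
  by rewrite eqr_nat => /eqP.
Qed.

(** The coordinates of the parametrization have real coefficients, so conjugation fixes them. *)
Lemma cusp_pullback_star p :
  cusp_pullback (star p) = map_poly (@conjc R) (cusp_pullback p).
Proof.
apply: (cusp_pullback_linear_ind
  (P := fun p f => cusp_pullback (star p) = map_poly (@conjc R) f)).
  by rewrite /star !rmorph0.
move=> a m q f IH; rewrite /star !rmorphD rmorphM /= -/(star q) IH.
rewrite (map_mpolyZ (@conjc R)) map_mpolyX cusp_pullbackZ map_polyC /=.
rewrite {1}/cusp_pullback mmapX rmorph_prod; congr (_ * _ + _).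
apply: eq_bigr => i _; rewrite rmorphXn; congr (_ ^+ _).
rewrite /cusp_coord.
by do 2?case: ifP => _; rewrite /= ?rmorph0 ?rmorphXn /= ?map_polyX.
Qed.

(** Vanishing of the linear coefficient is stable under products and sums, and holds for constants,
    [t^2] and [t^3]. *)
Lemma cusp_pullback_coef1 p : (cusp_pullback p)`_1 = 0.
Proof.
have coefM1 (f g : {poly C}) : f`_1 = 0 -> g`_1 = 0 -> (f * g)`_1 = 0.
  move=> f1 g1; rewrite coefM big_ord_recl big_ord1 /=.
  by rewrite subn0 g1 mulr0 add0r f1 mul0r.
have one1 : (1 : {poly C})`_1 = 0 by rewrite coef1.
apply: (cusp_pullback_linear_ind (P := fun _ f => f`_1 = 0)).
  by rewrite coef0.
move=> a m _ f f1; rewrite coefD f1 addr0 coefCM.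
suff -> : (\prod_i cusp_coord ('X : {poly C}) i ^+ m i)`_1 = 0 by rewrite mulr0.
apply: (big_ind (fun f : {poly C} => f`_1 = 0)) => // i _.
elim: (m i) => [|k IHk]; rewrite ?expr0// exprS coefM1//.
by rewrite /cusp_coord; do 2?case: ifP => _; rewrite ?coefXn ?coef0.
Qed.

Definition cusp_functional (p : cpoly R n) : C :=
  riesz_functional cusp_moment (cusp_pullback p).

Lemma cusp_functional_is_linear : scalar cusp_functional.
Proof.
move=> a p q; rewrite /cusp_functional rmorphD /= cusp_pullbackZ.
by rewrite mul_polyC linearP.
Qed.

HB.instance Definition _ :=
  GRing.isLinear.Build C (cpoly R n) C *%R cusp_functional
    cusp_functional_is_linear.

(** A quantitative bound rather than mere nonnegativity: it yields positive definiteness and also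
    determines the null ideal. *)
Lemma cusp_functional_ge p :
  2^-1 * \sum_(i < size (cusp_pullback p))
    `|2 ^+ (4 * i ^ 3) * (cusp_pullback p)`_i| ^+ 2 <=
  cusp_functional (star p * p).
Proof.
rewrite /cusp_functional rmorphM /= cusp_pullback_star.
set f := cusp_pullback p.
rewrite (@riesz_functionalM _ _ _ _ (size f)) ?size_map_poly//.
have f1 : f`_1 = 0 by exact: cusp_pullback_coef1.
apply: le_trans (cusp_moment_form_ge (f := nth 0 f) (size f) f1) _.
rewrite le_eqVlt; apply/predU1l.
by apply: eq_bigr => i _; apply: eq_bigr => j _; rewrite coef_map.
Qed.

Lemma cusp_functional_positive_definite : positive_definite cusp_functional.
Proof.
move=> p; apply: le_trans (cusp_functional_ge p).
rewrite mulr_ge0 ?invr_ge0 ?ler0n// sumr_ge0// => i _.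
exact: exprn_ge0.
Qed.

Lemma cusp_functional_null_ideal :
  null_ideal cusp_functional = vanishing_ideal (range cusp_point).
Proof.
apply/seteqP; split=> p; rewrite -cusp_pullback_eq0P /null_ideal /=; last first.
  by rewrite /cusp_functional rmorphM /= => ->; rewrite mulr0 linear0.
move=> Lp0; have := cusp_functional_ge p; rewrite Lp0.
rewrite pmulr_rle0 ?invr_gt0 ?ltr0n// => le0.
have /eqP : \sum_(i < size (cusp_pullback p))
    `|2 ^+ (4 * i ^ 3) * (cusp_pullback p)`_i| ^+ 2 = 0 :> C.
  by apply/le_anti; rewrite le0 sumr_ge0// => i _; exact: exprn_ge0.
(* Each weighted coefficient is zero, and the weights are nonzero, so the pullback itself is
   zero. *)
rewrite psumr_eq0; last by move=> i _; exact: exprn_ge0.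
move=> /allP f0; apply/polyP => k; rewrite coef0.
have [fk|kf] := leqP (size (cusp_pullback p)) k; first by rewrite nth_default.
have := f0 (Ordinal kf) (mem_index_enum _).
by rewrite /= expf_eq0 normr_eq0 mulf_eq0 expf_eq0 pnatr_eq0 andbF /= => /eqP.
Qed.

End Cusp.

(** * Nontriviality of the ideal and absence of a representing measure *)

Section CuspNotMoment.
Context {R : realType} {n : nat} (hn : (2 <= n)%N).
Local Notation C := (R[i]).

Let i0 : 'I_n := Ordinal (ltnW hn).
Let i1 : 'I_n := Ordinal hn.

Definition cusp_eqn : cpoly R n :=
  mpolyX C (mnm1 i1) ^+ 2 - mpolyX C (mnm1 i0) ^+ 3.

Lemma cusp_pullback_eqn : cusp_pullback cusp_eqn = 0.
Proof.
rewrite /cusp_eqn rmorphB !rmorphXn /= /cusp_pullback !mmapX !mmap1U.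
by rewrite /cusp_coord /= -!exprM subrr.
Qed.

Lemma cusp_eqn_neq0 : cusp_eqn != 0.
Proof.
(* At the point with [y = 1] and all other coordinates zero, the equation takes the value 1. *)
apply/eqP => /(congr1 (meval (fun i : 'I_n => (i == i1)%:R : C))).
rewrite meval0 /cusp_eqn mevalB !rmorphXn /= !mevalXU eqxx expr1n.
by rewrite (_ : i0 == i1 = false)// expr0n subr0 => /eqP; rewrite oner_eq0.
Qed.

Lemma vanishing_ideal_cusp_neq0 :
  vanishing_ideal (range (@cusp_point R n)) <> [set 0].
Proof.
move=> Z0; have : vanishing_ideal (range (@cusp_point R n)) cusp_eqn.
  by rewrite -cusp_pullback_eq0P cusp_pullback_eqn.
by rewrite Z0 /= => /eqP; rewrite (negbTE cusp_eqn_neq0).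
Qed.

(* Nonnegative everywhere: writing Q for [cusp_eqn], if [x < -1] then
   [Q >= -x^3], so [Q^2 >= x^6 >= -x]. *)
Definition cusp_witness : cpoly R n :=
  1 + mpolyX C (mnm1 i0) + star cusp_eqn * cusp_eqn.

Lemma Re_cusp_witness_ge0 x : 0 <= complex.Re (peval cusp_witness x).
Proof.
have -> : peval cusp_witness x =
    (1 + x ord0 i0 + (x ord0 i1 ^+ 2 - x ord0 i0 ^+ 3) ^+ 2)%:C%C.
  have eqnE : peval cusp_eqn x = (x ord0 i1 ^+ 2 - x ord0 i0 ^+ 3)%:C%C.
    by rewrite /peval /cusp_eqn rmorphB !rmorphXn /= !mevalXU rmorphB !rmorphXn.
  rewrite /cusp_witness /peval !mevalD mevalM meval1 mevalXU.
  rewrite [meval _ (star _)]peval_star [meval _ cusp_eqn]eqnE eqnE conjc_real.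
  by rewrite -rmorphM -(rmorph1 (real_complex R)) -!rmorphD expr2.
rewrite /=; move: (x ord0 i0) (x ord0 i1) => u v.
have [u1|u1] := leP 0 (1 + u); first by rewrite addr_ge0// sqr_ge0.
have -> : v ^+ 2 - u ^+ 3 = v ^+ 2 + (- u) ^+ 3 by ring.
have {}u1 : 1 <= - u by lra.
have u3 : - u <= (- u) ^+ 3 by rewrite -[leLHS]expr1 ler_weXn2l.
have v2 := sqr_ge0 v.
nra.
Qed.

(** The pullback kills the square term, so only [s_0 + s_2] remains. *)
Lemma cusp_functional_witness : cusp_functional cusp_witness = 1 - 2 ^+ 8.
Proof.
rewrite /cusp_functional /cusp_witness !rmorphD rmorphM /= cusp_pullback_eqn.
rewrite mulr0 addr0 rmorph1 /cusp_pullback mmapX mmap1U /cusp_coord /=.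
rewrite linearD /= riesz_functionalXn -(expr0 'X) riesz_functionalXn.
by rewrite /cusp_moment /= expr0 mul1r expr1 mulN1r.
Qed.

(** A representing measure would give the witness a nonnegative integral, against the value
    [1 - 2^8]. Since the witness is nonnegative on all of [R^n], the measure need not be shown to be
    concentrated on the cusp. *)
Lemma cusp_functional_not_moment :
  ~ moment_functional (@cusp_functional R n : {scalar cpoly R n}).
Proof.
move=> [mu [_ /(_ cusp_witness)]].
move=> /(etrans (esym cusp_functional_witness)) muE.
have := @Rintegral_ge0 _ _ _ mu setT
  (fun x => complex.Re (peval cusp_witness x))
  (fun x _ => Re_cusp_witness_ge0 x).
have -> : (\int[mu]_x complex.Re (peval cusp_witness x))%R = 1 - 2 ^+ 8.
  move: muE; rewrite -(rmorph1 (real_complex R)).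
  rewrite -(rmorph_nat (real_complex R) 2).
  by rewrite -rmorphXn -rmorphB => -[<- _].
lra.
Qed.

End CuspNotMoment.

Theorem mainTheorem6 (R : realType) (n : nat) (hn : (2 <= n)%N) :
  exists I : set (cpoly R n),
    [/\ is_set_ideal I, I <> [set 0] & ~ type_C I].
Proof.
exists (vanishing_ideal (range (@cusp_point R n))); split.
- by exists (range (@cusp_point R n)).
- exact: vanishing_ideal_cusp_neq0 hn.
- move=> /(_ _ cusp_functional_positive_definite cusp_functional_null_ideal).
  exact: cusp_functional_not_moment hn.
Qed.
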